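(* For every integer $k\ge 0$, \[ a_{k,n}=\operatorname{rk}H^{2k}(\overline{\mathcal M}_{0,n},\mathbb Q)\sim \frac{(k+1)^{k+n-1}}{(k+1)!}\quad\text{as } n\to\infty, \] i.e. the ratio of the two sides tends to $1$.
   Context: For $n\ge 3$, let $\overline{\mathcal M}_{0,n}$ be the moduli space of stable $n$-pointed rational curves over $\mathbb C$. Its class in $K(\mathrm{Var}_{\mathbb C})$ equals $P_n(\mathbb L)$ with $\mathbb L=[\mathbb A^1]$ and $P_n(t)=\sum_{k=0}^{n-3}a_{k,n}t^k\in\mathbb Z[t]$; $a_{k,n}=\operatorname{rk}H^{2k}(\overline{\mathcal M}_{0,n},\mathbb Q)$. Equivalently, $P_3(t)=1$ and for $n>3$, $P_n(t)=P_{n-1}(t)(1+t)+t\sum_{i=3}^{n-2}\binom{n-2}{i-1}P_i(t)P_{n+1-i}(t)$. *)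

(* Defs.v *)
From HB Require Import structures.
From mathcomp Require Import all_boot all_order all_algebra.
From mathcomp Require Import all_classical all_reals topology normedtype sequences.
Set Implicit Arguments. Unset Strict Implicit. Unset Printing Implicit Defensive.
Import Order.TTheory GRing.Theory Num.Theory.
Local Open Scope ring_scope.

(* One step of the recursion: given the table s = [P_0; ...; P_(n-1)],
   compute P_n.  Entries P_0, P_1, P_2 are dummy zeros (never used);
   P_3 = 1; for n > 3,
   P_n = P_(n-1) (1 + t) + t * sum_(i=3)^(n-2) C(n-2, i-1) P_i P_(n+1-i). *)
Definition M0n_step (n : nat) (s : seq {poly int}) : {poly int} :=
  if (n < 3)%N then 0
  else if n == 3%N then 1
  else nth 0 s n.-1 * (1 + 'X)
       + 'X * \sum_(3 <= i < n.-1) ('C(n - 2, i - 1))%:R * nth 0 s i * nth 0 s (n + 1 - i).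

Fixpoint M0n_table (m : nat) : seq {poly int} :=
  match m with
  | 0 => [:: M0n_step 0 [::]]
  | m'.+1 => rcons (M0n_table m') (M0n_step m'.+1 (M0n_table m'))
  end.

(* P_n(t), the class of \bar M_{0,n} in K(Var) as a polynomial in L (for n >= 3). *)
Definition P_M0n (n : nat) : {poly int} := nth 0 (M0n_table n) n.

(* a_{k,n} = coefficient of t^k in P_n = rk H^{2k}(\bar M_{0,n}, Q). *)
Definition a_coef (k n : nat) : int := (P_M0n n)`_k.

(* Main.v *)
(* Write c_k = (k + 1)^(k - 1) / (k + 1)!.  By induction on k one shows
     a_(k, n) = c_k (k + 1)^n + O((k + 1/2)^n).
   In the recursion for a_(k + 1, n) - a_(k + 1, n - 1) the leading terms of
   the binomial convolutions of a_p and a_(k - p) sum by the binomial theorem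
   to a multiple of (p + 1 + k - p + 1)^n = (k + 2)^n, while each product
   involving an error term has total rate at most k + 3/2.  The leading
   constants match because of
     sum_(p <= k) c_p c_(k - p) (p + 1) (k - p + 1)^2 = c_(k + 1) (k + 1) (k + 2),
   which is a form of Abel's binomial identity. *)
Require Import Defs.
From HB Require Import structures.
From mathcomp Require Import all_boot all_order all_algebra.
From mathcomp Require Import all_classical all_reals topology normedtype sequences.
From mathcomp Require Import ring lra zify.
Import Order.TTheory GRing.Theory Num.Theory numFieldNormedType.Exports.
Local Open Scope classical_set_scope.
Local Open Scope ring_scope.

(** * The recursion in terms of coefficients *)

Lemma size_M0n_table m : size (M0n_table m) = m.+1.
Proof. by elim: m => //= m IHm; rewrite size_rcons IHm. Qed.

Lemma nth_M0n_table m n : (n <= m)%N -> nth 0 (M0n_table m) n = P_M0n n.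
Proof.
elim: m => [|m IHm]; first by rewrite leqn0 => /eqP->.
rewrite leq_eqVlt => /orP[/eqP-> //|lt_nm] /=.
by rewrite nth_rcons size_M0n_table lt_nm IHm.
Qed.

Lemma P_M0n_S n : P_M0n n.+1 = M0n_step n.+1 (M0n_table n).
Proof. by rewrite /P_M0n /= nth_rcons size_M0n_table ltnn eqxx. Qed.

Lemma P_M0n_small n : (n < 3)%N -> P_M0n n = 0.
Proof. by case: n => [|n] // n_lt3; rewrite P_M0n_S /M0n_step n_lt3. Qed.

Lemma P_M0n3 : P_M0n 3 = 1.
Proof. by rewrite P_M0n_S. Qed.

(** With N = n - 2 and j = i - 1 the sum becomes a full binomial convolution: each added term j = 0,
    1 or N contains [P_M0n 1] or [P_M0n 2], which are 0. *)
Lemma P_M0n_rec N : (1 < N)%N ->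
  P_M0n N.+2 = P_M0n N.+1 * (1 + 'X)
    + 'X * \sum_(j < N.+1) 'C(N, j)%:R * P_M0n j.+1 * P_M0n (N - j).+2.
Proof.
move=> N_gt1; rewrite P_M0n_S /M0n_step.
have [-> ->] : (N.+2 < 3)%N = false /\ (N.+2 == 3)%N = false by lia.
rewrite nth_M0n_table // subn2 /=.
congr (_ + _ * _).
rewrite -(big_mkord predT (fun j => 'C(N, j)%:R * P_M0n j.+1 * P_M0n (N - j).+2)).
rewrite [in RHS]big_nat_recr //= subnn (@P_M0n_small 2) // mulr0 addr0.
rewrite -(big_add1 _ _ 0 N.+1 predT
  (fun i => 'C(N, i.-1)%:R * P_M0n i.-1.+1 * P_M0n (N - i.-1).+2)).
rewrite [in RHS](@big_cat_nat _ _ _ 3) //=.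
rewrite [X in _ = X + _]big_nat [X in _ = X + _]big1 ?add0r; last first.
  by move=> i /andP[i_gt0 i_lt3]; rewrite P_M0n_small ?mulr0 ?mul0r ?prednK.
apply: eq_big_nat => -[|i] // /andP[i_gt2 i_ltN] /=.
have -> : (N.+2 + 1 - i.+1 = (N - i).+2)%N by lia.
by rewrite -/(M0n_table N.+1) subn1 !nth_M0n_table //; lia.
Qed.

Lemma a_coef0 n : a_coef 0 n = (2 < n)%N%:R.
Proof.
have coef0M : forall p q : {poly int}, (p * q)`_0 = p`_0 * q`_0.
  by move=> p q; rewrite coefM big_ord1.
rewrite /a_coef; elim: n => [|n IHn]; first by rewrite P_M0n_small ?coef0.
case: (ltnP n 3) => [n_lt3|n_gt2].
  by case: n n_lt3 {IHn} => [|[|[|n]]] // _;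
    rewrite ?P_M0n3 ?coef1 ?P_M0n_small ?coef0.
case: n n_gt2 IHn => [|N] // N_gt1 IHn.
rewrite P_M0n_rec // coefD !coef0M coefD coefX coef1 mul0r !addr0 mulr1.
by rewrite IHn N_gt1 (leqW N_gt1).
Qed.

(* The recursion defining P_n only holds for n > 3; in positive degree it
   persists for n = 2, 3 thanks to the junk values P_0 = P_1 = P_2 = 0. *)
Lemma a_coef_rec k N :
  a_coef k.+1 N.+2 = a_coef k.+1 N.+1 + a_coef k N.+1
    + \sum_(p < k.+1) \sum_(j < N.+1)
        'C(N, j)%:R * a_coef p j.+1 * a_coef (k - p) (N - j).+2.
Proof.
case: (ltnP 1 N) => [N_gt1|N_le1]; last first.
  have a_small l n : (n < 3)%N -> a_coef l n = 0.
    by move=> n_lt3; rewrite /a_coef P_M0n_small ?coef0.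
  have -> : a_coef k.+1 N.+2 = 0.
    by case: N N_le1 => [|[|N]] // _; [rewrite a_small | rewrite /a_coef P_M0n3 coef1].
  rewrite !a_small // !add0r big1 // => p _; apply: big1 => j _.
  by rewrite (a_small p) ?mulr0 ?mul0r // (leq_ltn_trans (ltn_ord j)).
rewrite {1}/a_coef P_M0n_rec // coefD mulrDr mulr1 coefD coefMX.
rewrite [_.+1 == 0%N]eqn_leq ltn0 /= coefXM /=; congr (_ + _).
rewrite exchange_big /= coef_sum; apply: eq_bigr => j _.
rewrite -mulrA mulr_natl coefMn coefM -[LHS]mulr_natl mulr_sumr.
by apply: eq_bigr => p _; rewrite mulrA.
Qed.

(** * Abel's identity and the leading constants *)

(** The n-th finite difference kills polynomials of degree below n. The induction uses i C(n, i) = n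
    C(n - 1, i - 1) and expands the remaining power of i about i - 1. *)
Lemma alternating_bin_sum_eq0 (R : comNzRingType) n m : (m < n)%N ->
  \sum_(i < n.+1) (-1) ^+ i * 'C(n, i)%:R * i%:R ^+ m = 0 :> R.
Proof.
elim: n m => [|n IHn] // [|m] lt_mn.
  transitivity ((1 - 1 : R) ^+ n.+1); last by rewrite subrr expr0n.
  rewrite exprDn; apply: eq_bigr => i _.
  by rewrite expr1n mul1r expr0 mulr1 mulr_natr.
rewrite big_ord_recl expr0n mulr0 add0r.
transitivity (- n.+1%:R * \sum_(l < m.+1) 'C(m, l)%:R *
  \sum_(i < n.+1) (-1) ^+ i * 'C(n, i)%:R * i%:R ^+ l : R); last first.
  rewrite [X in _ * X]big1 ?mulr0 // => l _.
  by rewrite IHn ?mulr0 // (leq_trans (ltn_ord l)).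
under [in RHS]eq_bigr do rewrite mulr_sumr.
rewrite exchange_big mulr_sumr; apply: eq_bigr => i _ /=.
have -> : (\sum_(l < m.+1) 'C(m, l)%:R * ((-1) ^+ i * 'C(n, i)%:R * i%:R ^+ l) : R)
    = (-1) ^+ i * 'C(n, i)%:R * i.+1%:R ^+ m.
  rewrite -[i.+1%:R]nat1r exprDn [RHS]mulr_sumr; apply: eq_bigr => l _.
  by rewrite expr1n mul1r -[i%:R ^+ l *+ _]mulr_natl; ring.
have /esym := congr1 (fun x => x%:R : R) (mul_bin_diag n.+1 i).
rewrite /bump /= !natrM => eC; rewrite !exprS.
transitivity (- ((-1) ^+ i * i.+1%:R ^+ m * (i.+1%:R * 'C(n.+1, i.+1)%:R)) : R).
  by ring.
by rewrite eC; ring.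
Qed.

Lemma deriv_horner_inj (R : numDomainType) (p q : {poly R}) (a : R) :
  p^`() = q^`() -> p.[a] = q.[a] -> p = q.
Proof.
move=> dpq pqa; apply/eqP; rewrite -subr_eq0.
have pqC : p - q = ((p - q)`_0)%:P.
  apply/polyP => -[|i]; rewrite coefC //=.
  have /(congr1 (fun r : {poly R} => r`_i)) : (p - q)^`() = 0.
    by rewrite derivB dpq subrr.
  by rewrite coef_deriv coef0 => /eqP; rewrite mulrn_eq0 => /eqP.
have : (p - q).[a] = 0 by rewrite hornerD hornerN pqa subrr.
by rewrite pqC hornerC => ->.
Qed.

(* The coefficient of x in Abel's identity
   sum_i C(n, i) x (x + i)^(i - 1) (y + n - i)^(n - i) = (x + y + n)^n
   for n = m + 1 and i = p + 1, with y written 'X + a so that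
   differentiating turns (m, a) into (m - 1, a + 1). *)
Lemma Abel_identity (R : numDomainType) m (a : R) :
  \sum_(p < m.+1) 'C(m.+1, p.+1)%:R * p.+1%:R ^+ p *:
     ('X + (a + (m - p)%:R)%:P) ^+ (m - p)
  = m.+1%:R *: ('X + (a + m.+1%:R)%:P) ^+ m.
Proof.
elim: m a => [|m IHm] a.
  by rewrite big_ord1 /= binn !expr0 mul1r.
have shift : a + m.+2%:R = (a + 1) + m.+1%:R by rewrite -addrA nat1r.
(* The right-hand side vanishes at this point, and each base on the left becomes -(p + 1). What
   remains is, up to sign, the alternating sum with i = p + 1, whose term i = 0 is 0. *)
apply: (@deriv_horner_inj _ _ _ (- (a + m.+2%:R))).
  rewrite derivZ deriv_exp derivD derivX derivC addr0 mul1r /=.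
  rewrite shift -[_ ^+ m *+ _]scaler_nat -IHm big_ord_recr /= subnn expr0 derivD.
  rewrite derivZ derivC scaler0 addr0 (raddf_sum (@deriv R)) scaler_sumr.
  apply: eq_bigr => p _ /=; rewrite (subSn (leq_ord p)).
  rewrite derivZ deriv_exp derivD derivX derivC addr0 mul1r /=.
  rewrite -[_ *+ (m - p).+1]scaler_nat !scalerA.
  rewrite -[a + _ + _]addrA nat1r; congr (_ *: _).
  have /(congr1 (fun x => x%:R : R)) := mul_bin_down m.+2 p.+1.
  rewrite subSS (subSn (leq_ord p)) !natrM /= => eC.
  by rewrite mulrA eC; ring.
rewrite hornerZ horner_exp hornerD hornerX hornerC addNr expr0n /= mulr0.
rewrite horner_sum.
have := @alternating_bin_sum_eq0 R m.+2 m.+1 (leqnn _).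
rewrite big_ord_recl expr0n mulr0 add0r => /(congr1 (fun x => (-1) ^+ m.+2 * x)).
rewrite mulr0 mulr_sumr => eq0; rewrite -{}[RHS]eq0; apply: eq_bigr => p _.
rewrite hornerZ horner_exp hornerD hornerX hornerC /bump /=.
have p_le : (p <= m.+1)%N by rewrite -ltnS.
have -> : - (a + m.+2%:R) + (a + (m.+1 - p)%:R) = - (p.+1%:R) :> R.
  by rewrite natrB // -!natr1; ring.
have sign_eq : (-1) ^+ m.+2 = (-1) ^+ (m.+1 - p) * (-1) ^+ (1 + p) :> R.
  by rewrite -exprD; congr (_ ^+ _); lia.
have pow_eq : p.+1%:R ^+ m.+1 = p.+1%:R ^+ p * p.+1%:R ^+ (m.+1 - p) :> R.
  by rewrite -exprD subnKC.
rewrite [(- p.+1%:R) ^+ _]exprNn sign_eq pow_eq.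
set s := (-1) ^+ (1 + p).
have ss : s * s = 1 by rewrite -expr2 sqrr_sign.
transitivity ((s * s) * ('C(m.+2, p.+1)%:R * p.+1%:R ^+ p *
  ((-1) ^+ (m.+1 - p) * p.+1%:R ^+ (m.+1 - p)))); first by rewrite ss mul1r.
by ring.
Qed.

(* The limit (k + 1)^(k - 1) / (k + 1)! of a_(k, n) / (k + 1)^n, with the factor
   (k + 1)^(-1) kept apart because k - 1 would be truncated at k = 0. *)
Definition M0n_const (R : numFieldType) (k : nat) : R :=
  k.+1%:R ^+ k / (k.+1%:R * (k.+1)`!%:R).

Lemma M0n_const_ge0 (R : numFieldType) k : 0 <= M0n_const R k.
Proof. by rewrite divr_ge0 ?mulr_ge0 ?exprn_ge0. Qed.

(** Abel's identity for m = k + 1 and a = 0 is evaluated at 0, and its top term (k + 2)^(k + 1)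
    changes sides. Division by (k + 2)! then turns the binomials into the factorials of
    [M0n_const]. *)
Lemma M0n_const_conv (R : numFieldType) k :
  \sum_(p < k.+1)
     M0n_const R p * M0n_const R (k - p) * p.+1%:R * (k - p).+1%:R ^+ 2
  = M0n_const R k.+1 * k.+1%:R * k.+2%:R.
Proof.
have factN0 n : (n`!)%:R != 0 :> R by rewrite pnatr_eq0 -lt0n fact_gt0.
have SN0 n : n.+1%:R != 0 :> R by rewrite pnatr_eq0.
have /(congr1 (fun q => q.[0])) := @Abel_identity R k.+1 0.
rewrite big_ord_recr /= subnn expr0 binn mul1r hornerD.
rewrite !hornerZ horner_exp hornerD hornerX hornerC hornerC horner_sum !add0r mulr1.
move=> /(canRL (addrK _)) abel.
transitivity ((k.+2%:R * k.+2%:R ^+ k.+1 - k.+2%:R ^+ k.+1) / (k.+2)`!%:R : R).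
  rewrite -abel mulr_suml; apply: eq_bigr => p _.
  have p_le : (p <= k)%N by rewrite -ltnS.
  rewrite hornerZ horner_exp hornerD hornerX hornerC !add0r (subSn p_le).
  have p1_le : (p.+1 <= k.+2)%N by rewrite ltnS leqW.
  have eC : (k.+2)`!%:R = 'C(k.+2, p.+1)%:R * ((p.+1)`!%:R * ((k - p).+1)`!%:R) :> R.
    by rewrite -(bin_fact p1_le) subSS (subSn p_le) !natrM.
  apply: (canRL (mulfK (factN0 k.+2))).
  rewrite eC /M0n_const [_ ^+ (k - p).+1]exprSr.
  by field; rewrite !nat1r !factN0 !SN0.
by rewrite /M0n_const; field; rewrite factN0 -natrD SN0.
Qed.

(** * Propagation of the error bound *)

Lemma increments_geometric_bound (R : realFieldType) (u : nat -> R) (rho K : R) :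
  3 / 2 <= rho -> 0 <= K ->
  (forall N, `|u N.+2 - u N.+1| <= K * rho ^+ N) ->
  exists2 C : R, 0 <= C & forall n, `|u n| <= C * rho ^+ n.
Proof.
move=> rho_ge K_ge0 u_incr.
pose C := `|u 0%N| + `|u 1%N| + 2 * K.
have u0_ge0 := normr_ge0 (u 0%N); have u1_ge0 := normr_ge0 (u 1%N).
have C_ge0 : 0 <= C by rewrite /C; lra.
exists C => // -[|n]; first by rewrite expr0 mulr1 /C; lra.
elim: n => [|n IHn].
  rewrite expr1; suff : C * (3 / 2) <= C * rho by rewrite /C; lra.
  exact: ler_wpM2l.
rewrite -[u n.+2](subrK (u n.+1)) (le_trans (ler_normD _ _)) //.
apply: (le_trans (lerD (u_incr n) IHn)).
have rhon_ge0 : 0 <= rho ^+ n by rewrite exprn_ge0 //; lra.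
rewrite !exprS.
have -> : K * rho ^+ n + C * (rho * rho ^+ n) = (K + C * rho) * rho ^+ n by ring.
have -> : C * (rho * (rho * rho ^+ n)) = (C * rho * rho) * rho ^+ n by ring.
apply: ler_wpM2r => //; rewrite -subr_ge0.
(* Since rho (rho - 1) >= 3 / 4, the choice C >= 2 K more than covers the increment K. *)
have -> : C * rho * rho - (K + C * rho)
  = C * ((rho - 3 / 2) * (rho + 1 / 2)) + (C * (3 / 4) - K) by field.
apply: addr_ge0; first by rewrite mulr_ge0 ?mulr_ge0 //; lra.
by rewrite /C; lra.
Qed.

(** The rates of two geometric sequences add under binomial convolution; the shifts are those of
    [a_coef_rec]. *)
Lemma sum_bin_geometric (R : comNzRingType) (x y : R) N :
  \sum_(j < N.+1) 'C(N, j)%:R * x ^+ j.+1 * y ^+ (N - j).+2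
  = x * y ^+ 2 * (x + y) ^+ N.
Proof.
rewrite addrC exprDn mulr_sumr; apply: eq_bigr => j _.
by rewrite exprS 2!exprSr -mulr_natl; ring.
Qed.

Definition a_err (R : numFieldType) (k n : nat) : R :=
  (a_coef k n)%:~R - M0n_const R k * k.+1%:R ^+ n.

(** The error is -1 for n <= 2 and 0 afterwards; the constant 4 is forced by n = 2. *)
Lemma a_err0_le (R : realFieldType) n : `|a_err R 0 n| <= 4 * (1 / 2) ^+ n.
Proof.
rewrite /a_err /M0n_const a_coef0 expr0 expr1n !mulr1 divr1.
case: (ltnP 2 n) => [_|]; first by rewrite subrr normr0 mulr_ge0 ?exprn_ge0 //; lra.
rewrite mulr0z sub0r normrN normr1.
by case: n => [|[|[|n]]] // _; rewrite ?expr0 ?expr1 ?expr2; lra.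
Qed.

(** Products of two leading terms sum to c_(k + 1) ((k + 2)^(N + 2) - (k + 2)^(N + 1)) and cancel
    the leading part of the increment. Every product that survives contains an error factor. *)
Lemma a_err_rec (R : numFieldType) k N :
  a_err R k.+1 N.+2 - a_err R k.+1 N.+1
  = (a_coef k N.+1)%:~R + \sum_(p < k.+1) \sum_(j < N.+1) 'C(N, j)%:R *
      (a_err R p j.+1 * (a_coef (k - p) (N - j).+2)%:~R
       + M0n_const R p * p.+1%:R ^+ j.+1 * a_err R (k - p) (N - j).+2).
Proof.
have main : \sum_(p < k.+1) \sum_(j < N.+1) 'C(N, j)%:R *
    (M0n_const R p * p.+1%:R ^+ j.+1 *
      (M0n_const R (k - p) * (k - p).+1%:R ^+ (N - j).+2))
    = M0n_const R k.+1 * k.+1%:R * k.+2%:R * k.+2%:R ^+ N.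
  rewrite -M0n_const_conv mulr_suml; apply: eq_bigr => p _.
  have -> : k.+2%:R = p.+1%:R + (k - p).+1%:R :> R.
    by rewrite -natrD; congr (_%:R); have := ltn_ord p; lia.
  transitivity (M0n_const R p * M0n_const R (k - p) *
    (p.+1%:R * (k - p).+1%:R ^+ 2 * (p.+1%:R + (k - p).+1%:R) ^+ N)); last by ring.
  by rewrite -sum_bin_geometric mulr_sumr; apply: eq_bigr => j _; ring.
transitivity ((a_coef k N.+1)%:~R
  + \sum_(p < k.+1) \sum_(j < N.+1)
      ('C(N, j)%:R * a_coef p j.+1 * a_coef (k - p) (N - j).+2)%:~R
  - M0n_const R k.+1 * k.+1%:R * k.+2%:R * k.+2%:R ^+ N).
  rewrite /a_err a_coef_rec !rmorphD rmorph_sum /=.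
  under [\sum_(p < k.+1) (\sum__ _)%:~R]eq_bigr do rewrite rmorph_sum.
  by rewrite !exprS -[k.+2%:R]natr1 /=; ring.
rewrite -main -addrA; congr (_ + _); rewrite -sumrB; apply: eq_bigr => p _.
rewrite -sumrB; apply: eq_bigr => j _; rewrite /a_err !rmorphM /= rmorph_nat; ring.
Qed.

(** One constant serves all p <= k, because the convolution for k + 1 involves every smaller
    degree. *)
Lemma a_err_bound (R : realFieldType) k :
  exists2 C : R, 0 <= C &
    forall p n, (p <= k)%N -> `|a_err R p n| <= C * (p%:R + 1 / 2) ^+ n.
Proof.
elim: k => [|k [C C_ge0 a_errC]].
  exists 4 => // p n; rewrite leqn0 => /eqP ->; rewrite add0r; exact: a_err0_le.
(* [D] bounds both the coefficients, relative to (p + 1)^n, and the constants [M0n_const R p]. *)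
pose D := C + \sum_(p < k.+1) M0n_const R p.
have const_le p : (p <= k)%N -> M0n_const R p <= D - C.
  rewrite /D addrC addKr -ltnS => p_lt.
  rewrite (bigD1 (Ordinal p_lt)) //= lerDl sumr_ge0 // => i _.
  exact: M0n_const_ge0.
have const_ge0 p : 0 <= M0n_const R p by exact: M0n_const_ge0.
have aD p n : (p <= k)%N -> `|(a_coef p n)%:~R : R| <= D * p.+1%:R ^+ n.
  move=> p_le; have -> : (a_coef p n)%:~R = a_err R p n + M0n_const R p * p.+1%:R ^+ n.
    by rewrite /a_err subrK.
  rewrite (le_trans (ler_normD _ _)) // [`|_ * _|]ger0_norm; last first.
    by apply: mulr_ge0; [exact: const_ge0 | exact: exprn_ge0].
  have : M0n_const R p * p.+1%:R ^+ n <= (D - C) * p.+1%:R ^+ n.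
    by rewrite ler_wpM2r ?exprn_ge0 ?const_le.
  have : C * (p%:R + 1 / 2) ^+ n <= C * p.+1%:R ^+ n.
    have p_ge0 : 0 <= p%:R :> R by [].
    by rewrite ler_wpM2l // lerXn2r ?nnegrE //; lra.
  by have := a_errC p n p_le; lra.
have D_ge0 : 0 <= D by rewrite addr_ge0 // sumr_ge0.
pose rho : R := k.+1%:R + 1 / 2.
have k_ge0 : 0 <= k%:R :> R by [].
have rho_ge : 3 / 2 <= rho by rewrite /rho; lra.
(* The first term comes from [a_coef k]; the others are the prefactors x y^2 of [sum_bin_geometric]
   for the two mixed products, whose rates add up to exactly [rho]. *)
pose K := D * k.+1%:R + \sum_(p < k.+1) C * D *
  ((p%:R + 1 / 2) * (k - p).+1%:R ^+ 2 + p.+1%:R * ((k - p)%:R + 1 / 2) ^+ 2).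
have half_ge0 (i : nat) : 0 <= i%:R + 1 / 2 :> R by rewrite addr_ge0 //; lra.
have K_ge0 : 0 <= K.
  apply: addr_ge0; first exact: mulr_ge0.
  apply: sumr_ge0 => p _; apply: mulr_ge0; first exact: mulr_ge0.
  by rewrite addr_ge0 // mulr_ge0 // exprn_ge0.
have err_incr N : `|a_err R k.+1 N.+2 - a_err R k.+1 N.+1| <= K * rho ^+ N.
  rewrite a_err_rec mulrDl (le_trans (ler_normD _ _)) // lerD //.
    rewrite (le_trans (aD _ _ (leqnn k))) // exprS mulrA ler_wpM2l ?mulr_ge0 //.
    by rewrite lerXn2r ?nnegrE //; rewrite /rho; lra.
  rewrite mulr_suml (le_trans (ler_norm_sum _ _ _)) //; apply: ler_sum => p _.
  have p_le : (p <= k)%N by rewrite -ltnS.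
  have rhoEl : rho = (p%:R + 1 / 2) + (k - p).+1%:R.
    by rewrite /rho; have := natrB R p_le; lra.
  have rhoEr : rho = p.+1%:R + ((k - p)%:R + 1 / 2).
    by rewrite /rho; have := natrB R p_le; lra.
  rewrite -mulrA mulrDl {1}rhoEl rhoEr -!sum_bin_geometric -big_split mulr_sumr /=.
  rewrite (le_trans (ler_norm_sum _ _ _)) //; apply: ler_sum => j _.
  rewrite normrM normr_nat.
  rewrite [leRHS](_ : _ = 'C(N, j)%:R *
    (C * (p%:R + 1 / 2) ^+ j.+1 * (D * (k - p).+1%:R ^+ (N - j).+2)
     + D * p.+1%:R ^+ j.+1 * (C * ((k - p)%:R + 1 / 2) ^+ (N - j).+2))); last by ring.
  apply: ler_wpM2l => //; apply: (le_trans (ler_normD _ _)).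
  rewrite (normrM (a_err _ _ _)) (normrM (_ * _)) (normrM (M0n_const R p)).
  rewrite (ger0_norm (const_ge0 p)) normrX normr_nat.
  apply: lerD; apply: ler_pM => //.
  - exact: a_errC.
  - by apply: aD; exact: leq_subr.
  - by apply: mulr_ge0; [exact: const_ge0 | exact: exprn_ge0].
  - apply: ler_wpM2r; first exact: exprn_ge0.
    by have := const_le p p_le; lra.
  - by apply: a_errC; exact: leq_subr.
have [C1 C1_ge0 a_errC1] :=
  increments_geometric_bound _ _ _ _ rho_ge K_ge0 err_incr.
exists (C + C1) => [|p n]; first exact: addr_ge0.
rewrite leq_eqVlt mulrDl => /orP[/eqP-> | p_le].
  by rewrite (le_trans (a_errC1 n)) // lerDr mulr_ge0 ?exprn_ge0.
by rewrite (le_trans (a_errC p n p_le)) // lerDl mulr_ge0 ?exprn_ge0.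
Qed.

(** * Convergence of the ratio *)

Theorem theorem1p4 (R : realType) (k : nat) :
  (fun n : nat =>
     (a_coef k n)%:~R / (((k.+1)%:R : R) ^+ (k + n - 1) / ((k.+1)`!)%:R))
    @ \oo --> (1 : R).
Proof.
have [C C_ge0 errC] := a_err_bound R k.
(* [q] is the rate of the error divided by that of the leading term. *)
pose q : R := (k%:R + 1 / 2) / k.+1%:R.
have k1_gt0 : 0 < k.+1%:R :> R by rewrite ltr0n.
have c_gt0 : 0 < M0n_const R k.
  by rewrite divr_gt0 ?mulr_gt0 ?exprn_gt0 ?ltr0n ?fact_gt0.
have k_ge0 : 0 <= k%:R :> R by [].
have q_lt1 : `|q| < 1.
  rewrite ger0_norm ?divr_ge0 //; last by lra.
  by rewrite ltr_pdivrMr // mul1r; lra.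
have geom : (fun n => C / M0n_const R k * q ^+ n) @ \oo --> (0 : R).
  rewrite -[X in _ --> X](mulr0 (C / M0n_const R k)).
  by apply: cvgMr; exact: cvg_expr.
apply/cvgrPdist_le => e e_gt0; move/cvgrPdist_le: geom => /(_ e e_gt0).
(* For n > 0 the exponent k + n - 1 is not truncated, even at k = 0. *)
apply: filterS2 (nbhs_infty_gt 0) => n n_gt0.
rewrite sub0r normrN => /(le_trans (ler_norm _)); apply: le_trans.
have -> : k.+1%:R ^+ (k + n - 1) / (k.+1)`!%:R = M0n_const R k * k.+1%:R ^+ n.
  have -> : k.+1%:R ^+ (k + n - 1) = k.+1%:R ^+ k * k.+1%:R ^+ n / k.+1%:R :> R.
    by apply: (canRL (mulfK (lt0r_neq0 k1_gt0))); rewrite -exprSr -exprD; congr (_ ^+ _); lia.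
  by rewrite /M0n_const; field; rewrite nat1r (lt0r_neq0 k1_gt0) pnatr_eq0 -lt0n fact_gt0.
have pow_gt0 : 0 < k.+1%:R ^+ n :> R by rewrite exprn_gt0.
have pos : 0 < M0n_const R k * k.+1%:R ^+ n by exact: mulr_gt0.
have -> : 1 - (a_coef k n)%:~R / (M0n_const R k * k.+1%:R ^+ n)
    = - (a_err R k n / (M0n_const R k * k.+1%:R ^+ n)).
  by rewrite /a_err mulrBl divff ?lt0r_neq0 // opprB.
rewrite normrN normrM normfV (gtr0_norm pos) ler_pdivrMr //.
apply: (le_trans (errC k n (leqnn _))).
rewrite /q expr_div_n.
rewrite [leRHS](_ : _ = C * (k%:R + 1 / 2) ^+ n) //.
have := lt0r_neq0 c_gt0; have := lt0r_neq0 pow_gt0.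
set x := k.+1%:R ^+ n; set c := M0n_const R k; set y := (_ + _) ^+ n.
by move=> x0 c0; field; rewrite x0 c0.
Qed.
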